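(* Let $(u(n))_{n\ge0}$ be the integer sequence defined by $u(0)=1$ and $$u(n)=\prod_{j=1}^n(4j-1)^2-\sum_{m=0}^{n-1}\binom{2n+1}{2m+1}\Bigl(\prod_{j=1}^{n-m}(4j-3)^2\Bigr)u(m)\quad(n\ge1).$$ Then, given a prime $p\equiv3\pmod 4$ and an integer $e\ge2$, the number $u(n)$ is divisible by $p^e$ for all $n\ge\left\lfloor\frac{(e-1)p^2}{2}\right\rfloor$. *)

(* Defs.v *)
From HB Require Import structures.
From mathcomp Require Export all_boot all_order all_algebra.
Set Implicit Arguments.
Unset Strict Implicit.
Unset Printing Implicit Defensive.

(* Main.v *)
Require Import Defs.
From mathcomp Require Import all_boot all_order all_algebra.
From mathcomp Require Import zify ring.
Import Order.TTheory GRing.Theory Num.Theory.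

(** In terms of exponential generating functions the recurrence reads
    A(x) U(x) = B(x), where U has the coefficient u(n) x^(2n+1) / (2n+1)!,
    A has (prod_(j<k) (4j+1))^2 x^(2k) / (2k)! and B has
    (prod_(j<n) (4j+3))^2 x^(2n+1) / (2n+1)!.

    A product of h terms of an arithmetic progression with common difference
    prime to p is at least as divisible by p as h!
    ([fact_part_dvd_prod_progression]), and N! is more divisible by p than the
    square of (N/2)! by at most the number of powers p^i <= N with i > 0
    ([logn_fact_le_double_half]). Hence the coefficient of x^N in A or B has a
    denominator at most p^(trunc_log p N), which is at most
    p^(floor (N / (p+1))) for odd p unless N = p ([trunc_log_mul_succ_le]). The
    index p is odd, so it occurs only in B, and there the condition p = 3 mod 4
    makes one of the factors 4j+3 equal to p.

    Since floor is superadditive, the series whose N-th coefficient c satisfies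
    v_p(c) >= - floor (N / (p+1)) form a ring, and A has constant term 1, so
    U = B / A also belongs to it. With N = 2n+1 this says

      v_p(u(n)) >= v_p(N!) - floor (N / (p+1)).

    The hypothesis on n means N >= (e-1) p^2. Then Legendre's formula gives
    v_p(N!) >= floor (N/p) + floor (N/p^2) >= floor (N/p) + (e-1), and
    floor (N / (p+1)) < floor (N/p) as soon as N >= p^2, which leaves
    v_p(u(n)) >= e. *)

(** Modulo q the progression is d times the run t, t+1, ..., t+h-1, where t
    solves d t = a, and h! divides the product of any h consecutive
    integers. *)
Lemma dvdn_prod_progression q a d h :
  coprime d q -> q %| h`! -> q %| \prod_(j < h) (a + d * j).
Proof.
move=> co_dq q_fact.
have [t /eqP dt_a] : exists t, d * t = a %[mod q].
  have /dvdnP[t Et] : d %| chinese d q 0 a.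
    by rewrite /dvdn (chinese_modl co_dq) mod0n.
  by exists t; rewrite mulnC -Et (chinese_modr co_dq).
have prod_mod : \prod_(j < h) (a + d * j) = \prod_(j < h) (d * (t + j)) %[mod q].
  elim/big_ind2: _ => // [x1 x2 y1 y2 Ex Ey | j _].
    by rewrite -modnMm Ex Ey modnMm.
  by rewrite mulnDr; apply/eqP; rewrite eqn_modDr eq_sym.
have run : \prod_(j < h) (t + j) = 'C(t + h.-1, h) * h`!.
  rewrite bin_ffact ffact_prod (reindex_inj rev_ord_inj) /=.
  by apply: eq_bigr => j _; move: (ltn_ord j); clear; lia.
rewrite /dvdn prod_mod big_split /= run; apply: dvdn_mull.
exact: dvdn_mull.
Qed.

Lemma fact_part_dvd_prod_progression p a d h :
  prime p -> coprime d p -> (h`!)`_p %| \prod_(j < h) (a + d * j).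
Proof.
move=> p_pr co_dp; apply: dvdn_prod_progression (dvdn_part _ _).
by rewrite p_part coprimeXr.
Qed.

(** In Legendre's formula for N!, each power p^i contributes at most one more
    than twice its contribution to (N/2)!, and nothing once p^i > N. *)
Lemma logn_fact_le_double_half p N :
  prime p -> logn p N`! <= (logn p (N./2)`!).*2 + trunc_log p N.
Proof.
move=> p_pr; have p_gt1 := prime_gt1 p_pr.
have half_sum : logn p (N./2)`! = \sum_(1 <= i < N.+1) N./2 %/ p ^ i.
  rewrite logn_fact // (@big_cat_nat _ _ _ (N./2).+1 1 N.+1) //=; last by lia.
  rewrite [X in _ + X]big_nat_cond [X in _ + X]big1 ?addn0 // => i.
  rewrite andbT => /andP[lt_i _]; apply: divn_small.
  exact: leq_trans lt_i (ltnW (ltn_expl _ p_gt1)).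
have count_le : \sum_(1 <= i < N.+1) (i <= trunc_log p N : nat) <= trunc_log p N.
  rewrite -big_mkcond /= sum1_count /index_iota subn1 /= -size_filter.
  rewrite -[leqRHS](size_iota 1); apply: uniq_leq_size.
    by rewrite filter_uniq ?iota_uniq.
  by move=> i; rewrite mem_filter !mem_iota; lia.
rewrite logn_fact // half_sum -muln2 big_distrl /=.
apply: leq_trans (leq_add (leqnn _) count_le); rewrite -big_split /=.
apply: leq_sum => i _.
have q_gt0 : 0 < p ^ i by rewrite expn_gt0 prime_gt0.
have [le_iL | lt_Li] := leqP i.
  rewrite -ltnS ltn_divLR //.
  have := divn_eq N./2 (p ^ i); have := ltn_pmod N./2 q_gt0.
  by have := odd_double_half N; case: (odd N) => /=; nia.
rewrite divn_small //; apply: leq_trans (trunc_log_ltn N p_gt1) _.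
by rewrite leq_exp2l.
Qed.

Lemma mul_succ_le_expn p k : 2 < p -> 1 < k -> k * p.+1 <= p ^ k.
Proof.
move=> p_gt2; elim: k => // -[//|[_ _|k IHk _]]; first by nia.
by have := IHk isT; rewrite (expnS p k.+2); nia.
Qed.

(** If p^k <= N with k >= 2 then k (p+1) <= p^k; for k = 1 the claim p+1 <= N
    fails exactly at N = p. *)
Lemma trunc_log_mul_succ_le p N :
  2 < p -> N != p -> trunc_log p N * p.+1 <= N.
Proof.
move=> p_gt2 N_neq_p; have [->|N_gt0] := posnP N; first by rewrite trunc_log0.
have := trunc_logP (ltnW p_gt2) N_gt0.
case: (trunc_log p N) => [|[|k]] //; first by lia.
by apply: leq_trans; apply: mul_succ_le_expn.
Qed.

Local Open Scope ring_scope.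

(** The valuation of [x / N!], the coefficient attached to [x] in an
    exponential generating function, is at least minus the integer part of
    N / (p+1). *)
Definition egf_bounded (p N : nat) (x : int) : bool :=
  ((N`!`_p)%:Z %| (p ^ (N %/ p.+1))%:Z * x)%Z.

Lemma egf_boundedB p N x y :
  egf_bounded p N x -> egf_bounded p N y -> egf_bounded p N (x - y).
Proof. by rewrite /egf_bounded mulrBr => *; apply: rpredB. Qed.

Lemma egf_bounded_sum p N (r : seq nat) (P : pred nat) (F : nat -> int) :
  (forall i, P i -> egf_bounded p N (F i)) ->
  egf_bounded p N (\sum_(i <- r | P i) F i).
Proof. by rewrite /egf_bounded mulr_sumr => F_b; apply: rpred_sum. Qed.

(** The binomial coefficient turns the product of the coefficients x / M! and
    y / K! into the coefficient of degree M+K of a product of series; the two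
    bounds add up because the integer part is superadditive. *)
Lemma egf_boundedM p M K x y :
  egf_bounded p M x -> egf_bounded p K y ->
  egf_bounded p (M + K) ('C(M + K, M)%:Z * x * y).
Proof.
move=> x_b y_b; rewrite /egf_bounded.
have fact_split : ((M + K)`!`_p)%N = ('C(M + K, M)`_p * (M`!`_p * K`!`_p))%N.
  have := bin_fact (leq_addr K M); rewrite addKn => <-.
  by rewrite !partnM ?muln_gt0 ?fact_gt0 ?bin_gt0 ?leq_addr.
have [k ->] : exists k, ((M + K) %/ p.+1 = k + (M %/ p.+1 + K %/ p.+1))%N.
  by rewrite divnD //; eexists; rewrite addnC.
have -> : (p ^ (k + (M %/ p.+1 + K %/ p.+1)))%:Z * ('C(M + K, M)%:Z * x * y)
    = ((p ^ k)%:Z * 'C(M + K, M)%:Z)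
      * (((p ^ (M %/ p.+1))%:Z * x) * ((p ^ (K %/ p.+1))%:Z * y)).
  by rewrite !expnD !PoszM; ring.
rewrite fact_split !PoszM; apply: dvdz_mul; last exact: dvdz_mul.
by apply: dvdz_mull; rewrite dvdzE; apply: dvdn_part.
Qed.

Lemma egf_bounded_progression p N a :
  prime p -> odd p -> N != p ->
  egf_bounded p N ((\prod_(j < N./2) (a + 4 * j)) ^ 2)%N%:Z.
Proof.
move=> p_pr p_odd N_neq_p.
have p_gt2 : (2 < p)%N by apply: odd_prime_gt2.
have co_4p : coprime 4 p by rewrite (coprimeXl 2 (m := 2)) // coprime2n.
rewrite /egf_bounded -PoszM dvdzE /= p_part.
apply: (@dvdn_trans (p ^ (N %/ p.+1 + (logn p (N./2)`!) * 2))).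
  apply: dvdn_exp2l; apply: leq_trans (logn_fact_le_double_half _ _ p_pr) _.
  by rewrite muln2 addnC leq_add2r leq_divRL // trunc_log_mul_succ_le.
rewrite expnD expnM dvdn_mul // dvdn_exp2r // -p_part.
exact: fact_part_dvd_prod_progression.
Qed.

(** The integer part of p / (p+1) is 0, so the bound asks x / p! to be integral
    at p, and p! has p-adic valuation 1. *)
Lemma egf_bounded_prime_index p (x : int) :
  prime p -> (p%:Z %| x)%Z -> egf_bounded p p x.
Proof.
move=> p_pr p_dvd_x; have p_gt1 := prime_gt1 p_pr.
rewrite /egf_bounded divn_small // expn0 mul1r p_part logn_fact //.
rewrite big_ltn ?ltnS ?prime_gt0 // expn1 divnn prime_gt0 //.
rewrite big_nat_cond big1 => [|i]; first by rewrite addn0 expn1.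
by rewrite andbT => /andP[i_gt1 _]; rewrite divn_small // -{1}(expn1 p) ltn_exp2l.
Qed.

(** The only index missed by [egf_bounded_progression] is 2n+1 = p, and then
    the factor of index (p-3)/4 of the progression 3, 7, 11, ... is p. *)
Lemma egf_bounded_odd_progression p n :
  prime p -> p = 3 %[mod 4] ->
  egf_bounded p (2 * n + 1) ((\prod_(j < n) (3 + 4 * j)) ^ 2)%N%:Z.
Proof.
move=> p_pr p_mod4; have p_odd : odd p by lia.
have half_n : (2 * n + 1)./2 = n by lia.
have [Np|] := eqVneq (2 * n + 1)%N p; last first.
  by move/(egf_bounded_progression _ _ 3 p_pr p_odd); rewrite half_n.
rewrite Np; apply: egf_bounded_prime_index => //.
have j_lt : (p %/ 4 < n)%N by lia.
rewrite dvdzE /= (bigD1 (Ordinal j_lt)) //= expnMn dvdn_mulr //.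
have -> : (3 + 4 * (p %/ 4) = p)%N by lia.
exact: dvdn_exp.
Qed.

Lemma logn_fact_ge p N :
  prime p -> (p <= N)%N -> (N %/ p + N %/ p ^ 2 <= logn p N`!)%N.
Proof.
move=> p_pr le_pN; have := prime_gt1 p_pr => p_gt1.
rewrite logn_fact // big_ltn; last by lia.
by rewrite big_ltn ?expn1 ?addnA ?leq_addr //; lia.
Qed.

Lemma prod_sqr_progression (b : int) (a k : nat) :
  4 - b = a%:Z ->
  \prod_(1 <= j < k.+1) (4 * j%:Z - b) ^+ 2
    = ((\prod_(j < k) (a + 4 * j)) ^ 2)%N%:Z :> int.
Proof.
move=> ab; rewrite big_add1 big_mkord.
elim/big_ind2: _ => // [? x1 ? x2 -> -> | j _]; first by rewrite expnMn PoszM.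
have -> : 4 * (val j).+1%:Z - b = (a + 4 * val j)%N%:Z by lia.
by rewrite -rmorphXn.
Qed.

Theorem theorem9 (u : nat -> int)
    (u_0 : u 0%N = 1)
    (u_rec : forall n : nat, (1 <= n)%N ->
       u n = \prod_(1 <= j < n.+1) (4 * j%:Z - 1) ^+ 2
             - \sum_(0 <= m < n)
                 ('C(2 * n + 1, 2 * m + 1))%:Z
                 * (\prod_(1 <= j < (n - m).+1) (4 * j%:Z - 3) ^+ 2)
                 * u m)
    (p : nat) (p_prime : prime p) (p_mod4 : p = 3 %[mod 4])
    (e : nat) (e_ge2 : (2 <= e)%N)
    (n : nat) (n_ge : (((e - 1) * p ^ 2) %/ 2 <= n)%N) :
  ((p ^ e)%N%:Z %| u n)%Z.
Proof.
have p_gt1 := prime_gt1 p_prime; have p_odd : odd p by lia.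
have u_bounded m : egf_bounded p (2 * m + 1) (u m).
  elim/ltn_ind: m => -[_|m IHm].
    rewrite u_0 /egf_bounded mulr1 divn_small; last by lia.
    by rewrite dvdzE /= p_part (_ : _`! = 1%N) // logn1.
  rewrite u_rec // (@prod_sqr_progression 1 3) //; apply: egf_boundedB.
    exact: egf_bounded_odd_progression.
  (* The summand of index k is the term of A(x) U(x) in which A contributes its
     coefficient of even degree 2 (m + 1 - k), a degree different from p. *)
  rewrite big_nat; apply: egf_bounded_sum => k /andP[_ lt_km].
  have N_split : (2 * m.+1 + 1 = (2 * k + 1) + 2 * (m.+1 - k))%N by lia.
  rewrite (@prod_sqr_progression 3 1) // mulrAC N_split.
  apply: egf_boundedM _ _ _ _ _ (IHm _ lt_km) _.
  have half : (2 * (m.+1 - k))./2 = (m.+1 - k)%N by lia.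
  have := @egf_bounded_progression p (2 * (m.+1 - k))%N 1 p_prime p_odd.
  by rewrite half; apply; lia.
set N := (2 * n + 1)%N; have N_ge : ((e - 1) * p ^ 2 <= N)%N by rewrite /N; lia.
have N_ge_p2 : (p ^ 2 <= N)%N by apply: leq_trans N_ge; rewrite leq_pmull //; lia.
(* Write N = a p + b with b < p <= a; then N < a (p + 1). *)
have div_lt : (N %/ p.+1 < N %/ p)%N.
  rewrite ltn_divLR // mulnS.
  have p_le : (p <= N %/ p)%N by rewrite leq_divRL ?mulnn //; lia.
  have := divn_eq N p; have := ltn_pmod N (ltnW p_gt1); lia.
have val_ge : (N %/ p.+1 + e <= logn p N`!)%N.
  have e_le : (e - 1 <= N %/ p ^ 2)%N by rewrite leq_divRL ?expn_gt0 ?prime_gt0.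
  have le_pN : (p <= N)%N.
    by apply: leq_trans N_ge_p2; rewrite -mulnn leq_pmulr // ltnW.
  by move: (logn_fact_ge p N p_prime le_pN) e_le div_lt; clear; lia.
have := u_bounded n; rewrite /egf_bounded -/N p_part => fact_dvd.
have pow_neq0 : (p ^ (N %/ p.+1))%:Z != 0 by rewrite eqz_nat expn_eq0; lia.
rewrite -(dvdz_mul2l pow_neq0) -PoszM -expnD.
by apply: dvdz_trans fact_dvd; rewrite dvdzE /= dvdn_exp2l.
Qed.
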